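(* Let $(\mathbf{ctx},u,\dot u,\Sigma\dashv\Delta)$ be a plain dependent type theory with $\Pi$-types, given by rules $\Pi:\mathcal U.\Delta\mathcal U\to\mathcal U$ and $\lambda:\mathcal U.\Delta\dot{\mathcal U}\to\dot{\mathcal U}$. Write $\Pi_AB=\Pi(A,B)$ and $\lambda_Ab=\lambda(A,b)$. Then the following rules hold. ($\Pi$F) From $\Gamma\vdash A$ type and $\Gamma.A\vdash B$ type, deduce $\Gamma\vdash\Pi_AB$ type. ($\Pi$I) From $\Gamma\vdash A$ type and $\Gamma.A\vdash b:B$, deduce $\Gamma\vdash\lambda_Ab:\Pi_AB$. ($\Pi$E) From $\Gamma\vdash f:\Pi_AB$ and $\Gamma\vdash a:A$, deduce $\Gamma\vdash f(a):B[a]$. ($\Pi\beta$) From $\Gamma.A\vdash b:B$ and $\Gamma\vdash a:A$, deduce $\Gamma\vdash(\lambda_Ab)(a)=b[a]:B[a]$. ($\Pi\eta$) From $\Gamma\vdash f:\Pi_AB$, deduce $\Gamma\vdash f=\lambda_A(f_B):\Pi_AB$. ($\Pi$F=) From $\Gamma\vdash A=A'$ type and $\Gamma.A\vdash B=B'$ type, deduce $\Gamma\vdash\Pi_AB=\Pi_{A'}B'$ type. ($\Pi$I=) From $\Gamma\vdash A=A$ type and $\Gamma.A\vdash b=b':B$, deduce $\Gamma\vdash\lambda_Ab=\lambda_Ab':\Pi_AB$. ($\Pi$E=) From $\Gamma\vdash f=f':\Pi_AB$ and $\Gamma\vdash a=a':A$, deduce $\Gamma\vdash f(a)=f'(a'):B[a]$.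 Here $f_B$ and $f(a)$ are obtained as follows. Let $\mathcal Q$ be the pullback of $\dot{\mathcal U}.\Sigma\Delta\mathcal U\to\mathcal U.\Delta\mathcal U\xrightarrow{\Pi}\mathcal U$ (the first functor being $(a,B)\mapsto(\Sigma a,B)$) along $\Sigma:\dot{\mathcal U}\to\mathcal U$; its objects are the quadruples $(A,B,f,a)$ with $\Sigma a=A$, $B$ a type over $\Gamma.A$ and $\Sigma f=\Pi_AB$. Then $\mathcal Q\cong\dot{\mathcal U}.\Sigma\Delta\dot{\mathcal U}$, via mutually inverse functors $$\theta:(a,b)\mapsto(A,B,\lambda_Ab,a),\qquad \zeta:(A,B,f,a)\mapsto(a,f_B),$$ where $A=\Sigma a$, $B=\Sigma b$ in the first and $f_B$ is a term of type $B$ over $\Gamma.A$ in the second. With $\dot\gamma:\dot{\mathcal U}.\Sigma\Delta\dot{\mathcal U}\to\dot{\mathcal U}$, $(a,b)\mapsto b[a]$, the elimination rule is the functor $\dot\gamma\zeta$, that is $f(a):=f_B[a]$; ($\Pi\beta$) is the equality $\dot\gamma\zeta\theta=\dot\gamma$; and ($\Pi\eta$) is what $\theta\zeta=\mathrm{id}$ says.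
   Context: Plain dependent type theory: a category $\mathbf{ctx}$ (with terminal object), fibrations (with given cleavages) $u:\mathcal U\to\mathbf{ctx}$ (types) and $\dot u:\dot{\mathcal U}\to\mathbf{ctx}$ (terms), a functor $\Sigma:\dot{\mathcal U}\to\mathcal U$ (typing) with $u\Sigma=\dot u$, and a right adjoint $\Delta:\mathcal U\to\dot{\mathcal U}$ of $\Sigma$ (not required to commute with the functors to $\mathbf{ctx}$), with unit $\eta$ and counit $\epsilon$, such that $\Sigma$ and $\Delta$ preserve cartesian morphisms and the components of $\eta$ and $\epsilon$ are cartesian. Formally, it is the judgemental theory generated by these data, i.e. the smallest collection of functors (''rules'') and natural transformations (''policies'') containing them and closed under composition, finite limits (pullbacks, equalizers, finite powers, with projections and induced functors), whiskering, and lifting of policies along fibrations by cartesian reindexing. Judgements: ''$\Gamma\vdash A$ type'' means $A\in\mathcal U$ with $u(A)=\Gamma$ (''$A$ is a type over $\Gamma$''); ''$\Gamma\vdash a:A$'' means $a\in\dot{\mathcal U}$ with $\dot u(a)=\Gamma$ and $\Sigma a=A$ (''$a$ is a term of type $A$ over $\Gamma$''); ''$\Gamma\vdash A=A'$ type'' and ''$\Gamma\vdash a=a':A$'' mean equality of objects of $\mathcal U$, respectively of $\dot{\mathcal U}$, lying over $\Gamma$ (and, for terms, both of type $A$). Put $\Gamma.A=\dot u\Delta A$ for $A$ over $\Gamma$. $\mathcal U.\Delta\mathcal U$ is the pullback of $\dot u\Delta$ and $u$ (pairs $(A,B)$, $B$ a type over $\Gamma.A$); $\mathcal U.\Delta\dot{\mathcal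 U}$ is the pullback of $\dot u\Delta$ and $\dot u$ (pairs $(A,b)$, $b$ a term over $\Gamma.A$); $\dot{\mathcal U}.\Sigma\Delta\mathcal U$ is the pullback of $\dot u\Delta\Sigma$ and $u$ (pairs $(a,B)$, $B$ a type over $\Gamma.\Sigma a$); $\dot{\mathcal U}.\Sigma\Delta\dot{\mathcal U}$ is the pullback of $\dot u\Delta\Sigma$ and $\dot u$ (pairs $(a,b)$, $b$ a term over $\Gamma.\Sigma a$). $v:\mathcal U.\Delta\mathcal U\to\mathbf{ctx}$ is $(A,B)\mapsto u(A)$. $\Pi$-types: a plain dependent type theory has $\Pi$-types if it has two additional rules $\Pi:\mathcal U.\Delta\mathcal U\to\mathcal U$ and $\lambda:\mathcal U.\Delta\dot{\mathcal U}\to\dot{\mathcal U}$ such that $u\Pi=v$ and the square with $\lambda$ on top, $\Pi$ on the bottom, $(A,b)\mapsto(A,\Sigma b)$ on the left and $\Sigma$ on the right commutes and is a pullback. Substitution: for $\Gamma\vdash a:A$ and $B$ a type (resp. $b$ a term) over $\Gamma.A$, $B[a]$ (resp. $b[a]$) is the cartesian reindexing of $B$ (resp. $b$) along $\dot u(\eta_a):\Gamma\to\dot u\Delta\Sigma a=\Gamma.A$; these give functors $\gamma:\dot{\mathcal U}.\Sigma\Delta\mathcal U\to\mathcal U$, $(a,B)\mapsto B[a]$, and $\dot\gamma:\dot{\mathcal U}.\Sigma\Delta\dot{\mathcal U}\to\dot{\mathcal U}$, $(a,b)\mapsto b[a]$, for which the square $\Sigma(b[a])=(\Sigma b)[a]$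 commutes. *)

(* Defs.v *)
From Stdlib Require Import FunctionalExtensionality ProofIrrelevance ClassicalEpsilon.

Set Implicit Arguments.
Unset Strict Implicit.
Unset Printing Implicit Defensive.

(* Everything is strict: equality of objects, of morphisms and of functors is
   Leibniz equality (see [functor_ext] for the latter). *)

Record Category := MkCategory {
  ob :> Type;
  hom : ob -> ob -> Type;
  idm : forall x, hom x x;
  cmp : forall x y z, hom y z -> hom x y -> hom x z;
  cmp_idl : forall x y (f : hom x y), cmp (idm y) f = f;
  cmp_idr : forall x y (f : hom x y), cmp f (idm x) = f;
  cmp_assoc : forall x y z w (h : hom z w) (g : hom y z) (f : hom x y),
    cmp h (cmp g f) = cmp (cmp h g) f }.

Arguments hom {_} _ _.
Arguments idm {_} _.
Arguments cmp {_ _ _ _} _ _.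

Notation "g '\o' f" := (cmp g f) (at level 50, left associativity).

Record Functor (C D : Category) := MkFunctor {
  fob :> C -> D;
  fmor : forall x y, hom x y -> hom (fob x) (fob y);
  fmor_id : forall x, fmor (idm x) = idm (fob x);
  fmor_cmp : forall x y z (g : hom y z) (f : hom x y),
    fmor (g \o f) = fmor g \o fmor f }.

Arguments fmor {_ _} _ {_ _} _.

Definition FId (C : Category) : Functor C C.
Proof. now refine (@MkFunctor C C (fun x => x) (fun x y f => f) _ _). Defined.

Definition FComp (C D E : Category) (G : Functor D E) (F : Functor C D) :
  Functor C E.
Proof.
refine (@MkFunctor C E (fun x => G (F x)) (fun x y f => fmor G (fmor F f)) _ _).
- intros x. now rewrite !fmor_id.
- intros x y z g f. now rewrite !fmor_cmp.
Defined.

Notation "G '\O' F" := (FComp G F) (at level 50, left associativity).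

(* The identity morphism of an object, seen as a morphism between two equal
   objects.  Equations between morphisms whose end points are only
   propositionally equal are stated by composing with these. *)
Definition eq_arr (C : Category) (x y : C) (e : x = y) : hom x y :=
  match e in _ = z return hom x z with eq_refl => idm x end.

Lemma eq_arr_trans (C : Category) (x y z : C) (e : x = y) (e' : y = z) :
  eq_arr e' \o eq_arr e = eq_arr (eq_trans e e').
Proof. destruct e'. apply cmp_idl. Qed.

Lemma eq_arr_irr (C : Category) (x y : C) (e e' : x = y) : eq_arr e = eq_arr e'.
Proof. now rewrite (proof_irrelevance _ e e'). Qed.

Lemma eq_arr_id (C : Category) (x : C) (e : x = x) : eq_arr e = idm x.
Proof. exact (eq_arr_irr e eq_refl). Qed.

Lemma eq_arr_fmor (C D : Category) (F : Functor C D) (x y : C) (e : x = y) :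
  fmor F (eq_arr e) = eq_arr (f_equal F e).
Proof. destruct e. apply fmor_id. Qed.

Lemma functor_ext (C D : Category) (F G : Functor C D)
    (e : forall x, F x = G x) :
  (forall x y (f : hom x y),
     eq_arr (e y) \o fmor F f = fmor G f \o eq_arr (e x)) -> F = G.
Proof.
destruct F as [F Fm Fi Fc], G as [G Gm Gi Gc]; simpl in *; intros H.
assert (E : F = G) by now apply functional_extensionality.
destruct E.
assert (E : Fm = Gm).
{ extensionality x. extensionality y. extensionality f.
  specialize (H x y f). now rewrite !eq_arr_id, cmp_idl, cmp_idr in H. }
destruct E. f_equal; apply proof_irrelevance.
Qed.

Lemma functor_eq_irr (C D : Category) (F : C -> D)
    (Fm : forall x y, hom x y -> hom (F x) (F y)) i i' c c' :
  @MkFunctor C D F Fm i c = @MkFunctor C D F Fm i' c'.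
Proof. f_equal; apply proof_irrelevance. Qed.

Lemma FComp_assoc (A B C D : Category) (H : Functor C D) (G : Functor B C)
    (F : Functor A B) : H \O (G \O F) = H \O G \O F.
Proof. apply functor_eq_irr. Qed.

Lemma fob_eq (C D : Category) (F G : Functor C D) (e : F = G) (x : C) :
  F x = G x.
Proof. now destruct e. Qed.

Lemma fmor_eq (C D : Category) (F G : Functor C D) (e : F = G) (x y : C)
    (f : hom x y) :
  eq_arr (fob_eq e y) \o fmor F f = fmor G f \o eq_arr (fob_eq e x).
Proof. destruct e. now rewrite !eq_arr_id, cmp_idl, cmp_idr. Qed.

Record NatTrans (C D : Category) (F G : Functor C D) := MkNatTrans {
  ncomp :> forall x, hom (F x) (G x);
  ncomp_nat : forall x y (f : hom x y),
    ncomp y \o fmor F f = fmor G f \o ncomp x }.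

Definition eq_nat (C D : Category) (F G : Functor C D) (e : F = G) :
  NatTrans F G :=
  @MkNatTrans C D F G (fun x => eq_arr (fob_eq e x)) (fmor_eq e).

Definition vcomp (C D : Category) (F G H : Functor C D) (t : NatTrans G H)
  (s : NatTrans F G) : NatTrans F H.
Proof.
refine (@MkNatTrans C D F H (fun x => t x \o s x) _).
intros x y f.
now rewrite <- cmp_assoc, ncomp_nat, cmp_assoc, ncomp_nat, cmp_assoc.
Defined.

Definition whiskerL (C D E : Category) (K : Functor D E) (F G : Functor C D)
  (t : NatTrans F G) : NatTrans (K \O F) (K \O G).
Proof.
refine (@MkNatTrans C E (K \O F) (K \O G) (fun x => fmor K (t x)) _).
intros x y f; simpl. now rewrite <- !fmor_cmp, ncomp_nat.
Defined.

Definition whiskerR (B C D : Category) (F G : Functor C D) (t : NatTrans F G)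
  (K : Functor B C) : NatTrans (F \O K) (G \O K) :=
  @MkNatTrans B D (F \O K) (G \O K) (fun x => t (K x))
    (fun x y f => ncomp_nat t (fmor K f)).

Record Adjunction (C D : Category) (L : Functor C D) (R : Functor D C) :=
  MkAdjunction {
    unit : NatTrans (FId C) (R \O L);
    counit : NatTrans (L \O R) (FId D);
    triangleL : forall x : C, counit (L x) \o fmor L (unit x) = idm (L x);
    triangleR : forall y : D, fmor R (counit y) \o unit (R y) = idm (R y) }.

Section Pullback.
Variables (A B C : Category) (F : Functor A C) (G : Functor B C).

Record pb_ob := MkPb { pbo1 : A; pbo2 : B; pbo_eq : F pbo1 = G pbo2 }.

Record pb_hom (x y : pb_ob) := MkPbHom {
  pbh1 : hom (pbo1 x) (pbo1 y);
  pbh2 : hom (pbo2 x) (pbo2 y);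
  pbh_eq : eq_arr (pbo_eq y) \o fmor F pbh1 = fmor G pbh2 \o eq_arr (pbo_eq x) }.

Lemma pb_hom_ext (x y : pb_ob) (f g : pb_hom x y) :
  pbh1 f = pbh1 g -> pbh2 f = pbh2 g -> f = g.
Proof.
destruct f, g; simpl; intros; subst; f_equal; apply proof_irrelevance.
Qed.

Definition Pullback : Category.
Proof.
unshelve refine (@MkCategory pb_ob pb_hom
  (fun x => @MkPbHom x x (idm _) (idm _) _)
  (fun x y z g f => @MkPbHom x z (pbh1 g \o pbh1 f) (pbh2 g \o pbh2 f) _)
  _ _ _).
- now rewrite !fmor_id, cmp_idl, cmp_idr.
- now rewrite !fmor_cmp, cmp_assoc, pbh_eq, <- cmp_assoc, pbh_eq, cmp_assoc.
- intros; apply pb_hom_ext; apply cmp_idl.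
- intros; apply pb_hom_ext; apply cmp_idr.
- intros; apply pb_hom_ext; apply cmp_assoc.
Defined.

Definition pb1 : Functor Pullback A :=
  @MkFunctor Pullback A pbo1 (fun x y f => pbh1 f)
    (fun _ => eq_refl) (fun _ _ _ _ _ => eq_refl).

Definition pb2 : Functor Pullback B :=
  @MkFunctor Pullback B pbo2 (fun x y f => pbh2 f)
    (fun _ => eq_refl) (fun _ _ _ _ _ => eq_refl).

Lemma pb_square : F \O pb1 = G \O pb2.
Proof.
exact (@functor_ext Pullback C (F \O pb1) (G \O pb2) pbo_eq
         (fun x y f => pbh_eq f)).
Qed.

Definition pb_pair (X : Category) (H : Functor X A) (K : Functor X B)
  (e : F \O H = G \O K) : Functor X Pullback.
Proof.
unshelve refine (@MkFunctor X Pullback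
  (fun x => @MkPb (H x) (K x) (fob_eq e x))
  (fun x y f => @MkPbHom (MkPb (fob_eq e x)) (MkPb (fob_eq e y))
                  (fmor H f) (fmor K f) (fmor_eq e f)) _ _).
- intros x; apply pb_hom_ext; apply fmor_id.
- intros x y z g f; apply pb_hom_ext; apply fmor_cmp.
Defined.

Lemma pb1_pair (X : Category) (H : Functor X A) (K : Functor X B)
    (e : F \O H = G \O K) : pb1 \O pb_pair e = H.
Proof. destruct H. apply functor_eq_irr. Qed.

Lemma pb2_pair (X : Category) (H : Functor X A) (K : Functor X B)
    (e : F \O H = G \O K) : pb2 \O pb_pair e = K.
Proof. destruct K. apply functor_eq_irr. Qed.

Lemma pb_ob_ext (x y : pb_ob) : pbo1 x = pbo1 y -> pbo2 x = pbo2 y -> x = y.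
Proof.
destruct x, y; simpl; intros; subst; f_equal; apply proof_irrelevance.
Qed.

Lemma pb_functor_ext (X : Category) (H K : Functor X Pullback) :
  pb1 \O H = pb1 \O K -> pb2 \O H = pb2 \O K -> H = K.
Proof.
intros e1 e2.
apply (@functor_ext X Pullback H K (fun x => pb_ob_ext (fob_eq e1 x) (fob_eq e2 x))).
intros x y f. apply pb_hom_ext.
- change (fmor pb1 (eq_arr (C := Pullback) (pb_ob_ext (fob_eq e1 y) (fob_eq e2 y)))
    \o fmor (pb1 \O H) f = fmor (pb1 \O K) f \o
    fmor pb1 (eq_arr (C := Pullback) (pb_ob_ext (fob_eq e1 x) (fob_eq e2 x)))).
  rewrite !eq_arr_fmor.
  rewrite (eq_arr_irr _ (fob_eq e1 y)), (eq_arr_irr _ (fob_eq e1 x)).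
  exact (fmor_eq e1 f).
- change (fmor pb2 (eq_arr (C := Pullback) (pb_ob_ext (fob_eq e1 y) (fob_eq e2 y)))
    \o fmor (pb2 \O H) f = fmor (pb2 \O K) f \o
    fmor pb2 (eq_arr (C := Pullback) (pb_ob_ext (fob_eq e1 x) (fob_eq e2 x)))).
  rewrite !eq_arr_fmor.
  rewrite (eq_arr_irr _ (fob_eq e2 y)), (eq_arr_irr _ (fob_eq e2 x)).
  exact (fmor_eq e2 f).
Qed.

Definition is_pullback (P : Category) (p : Functor P A) (q : Functor P B) : Prop :=
  F \O p = G \O q /\
  forall (X : Category) (H : Functor X A) (K : Functor X B),
    F \O H = G \O K -> exists! L : Functor X P, p \O L = H /\ q \O L = K.

Definition pb_induced (P : Category) (p : Functor P A) (q : Functor P B)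
  (pb : is_pullback p q) (X : Category) (H : Functor X A) (K : Functor X B)
  (e : F \O H = G \O K) : { L : Functor X P | p \O L = H /\ q \O L = K } :=
  constructive_definite_description _ (proj2 pb X H K e).

End Pullback.

Section Equalizer.
Variables (A C : Category) (F G : Functor A C).

Record eq_ob := MkEq { eqo : A; eqo_eq : F eqo = G eqo }.

Record eq_hom (x y : eq_ob) := MkEqHom {
  eqh : hom (eqo x) (eqo y);
  eqh_eq : eq_arr (eqo_eq y) \o fmor F eqh = fmor G eqh \o eq_arr (eqo_eq x) }.

Lemma eq_hom_ext (x y : eq_ob) (f g : eq_hom x y) : eqh f = eqh g -> f = g.
Proof.
destruct f, g; simpl; intros; subst; f_equal; apply proof_irrelevance.
Qed.

Definition Equalizer : Category.
Proof.
unshelve refine (@MkCategory eq_ob eq_hom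
  (fun x => @MkEqHom x x (idm _) _)
  (fun x y z g f => @MkEqHom x z (eqh g \o eqh f) _) _ _ _).
- now rewrite !fmor_id, cmp_idl, cmp_idr.
- now rewrite !fmor_cmp, cmp_assoc, eqh_eq, <- cmp_assoc, eqh_eq, cmp_assoc.
- intros; apply eq_hom_ext; apply cmp_idl.
- intros; apply eq_hom_ext; apply cmp_idr.
- intros; apply eq_hom_ext; apply cmp_assoc.
Defined.

Definition eq_incl : Functor Equalizer A :=
  @MkFunctor Equalizer A eqo (fun x y f => eqh f)
    (fun _ => eq_refl) (fun _ _ _ _ _ => eq_refl).

Definition is_equalizer (E : Category) (i : Functor E A) : Prop :=
  F \O i = G \O i /\
  forall (X : Category) (H : Functor X A),
    F \O H = G \O H -> exists! L : Functor X E, i \O L = H.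

End Equalizer.

Definition below (n : nat) : Type := { i : nat | i < n }.

Definition Power (n : nat) (A : Category) : Category.
Proof.
refine (@MkCategory (below n -> A) (fun x y => forall i, hom (x i) (y i))
  (fun x i => idm (x i)) (fun x y z g f i => g i \o f i) _ _ _);
  intros; extensionality i.
- apply cmp_idl.
- apply cmp_idr.
- apply cmp_assoc.
Defined.

Definition pow_proj (n : nat) (A : Category) (i : below n) :
  Functor (Power n A) A :=
  @MkFunctor (Power n A) A (fun x => x i) (fun x y f => f i)
    (fun _ => eq_refl) (fun _ _ _ _ _ => eq_refl).

Definition is_power (n : nat) (A P : Category) (p : below n -> Functor P A) : Prop :=
  forall (X : Category) (H : below n -> Functor X A),
    exists! L : Functor X P, forall i, p i \O L = H i.

Definition cartesian (E B : Category) (p : Functor E B) (x y : E) (f : hom x y) : Prop :=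
  forall (z : E) (g : hom z y) (h : hom (p z) (p x)),
    fmor p f \o h = fmor p g ->
    exists! k : hom z x, fmor p k = h /\ f \o k = g.

Definition preserves_cartesian (E E' B : Category) (p : Functor E B)
  (p' : Functor E' B) (F : Functor E E') : Prop :=
  forall (x y : E) (f : hom x y), cartesian p f -> cartesian p' (fmor F f).

Record Cleavage (E B : Category) (p : Functor E B) := MkCleavage {
  lift_ob : forall (y : E) (b : B), hom b (p y) -> E;
  lift_arr : forall (y : E) (b : B) (f : hom b (p y)), hom (lift_ob f) y;
  lift_over : forall (y : E) (b : B) (f : hom b (p y)), p (lift_ob f) = b;
  lift_arr_over : forall (y : E) (b : B) (f : hom b (p y)),
    fmor p (lift_arr f) = f \o eq_arr (lift_over f);
  lift_cart : forall (y : E) (b : B) (f : hom b (p y)),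
    cartesian p (lift_arr f) }.

Arguments lift_ob {_ _ _} _ {_ _} _.
Arguments lift_arr {_ _ _} _ {_ _} _.
Arguments lift_over {_ _ _} _ {_ _} _.
Arguments lift_arr_over {_ _ _} _ {_ _} _.
Arguments lift_cart {_ _ _} _ {_ _} _.

(* The lifting of [t : F => p G] along the cloven fibration [p]: a functor
   [reindex : x |-> (t x)^* (G x)] over [F], and a natural transformation
   [reindex_nat : reindex => G] with cartesian components. *)
Section Reindex.
Variables (E B : Category) (p : Functor E B) (c : Cleavage p).
Variables (X : Category) (F : Functor X B) (G : Functor X E).
Variable (t : NatTrans F (p \O G)).

Definition reindex_ob (x : X) : E := lift_ob c (t x).

Definition reindex_base (x y : X) (f : hom x y) :
  hom (p (reindex_ob x)) (p (reindex_ob y)) :=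
  eq_arr (eq_sym (lift_over c (t y))) \o fmor F f \o eq_arr (lift_over c (t x)).

Lemma reindex_base_eq (x y : X) (f : hom x y) :
  fmor p (lift_arr c (t y)) \o reindex_base f =
  fmor p (fmor G f \o lift_arr c (t x)).
Proof.
unfold reindex_base.
rewrite fmor_cmp, !lift_arr_over, !cmp_assoc, <- (cmp_assoc (t y)).
rewrite eq_arr_trans, eq_arr_id, cmp_idr.
pose proof (ncomp_nat t f) as N; simpl in N. now rewrite N.
Qed.

Definition reindex_arr (x y : X) (f : hom x y) :
  { k : hom (reindex_ob x) (reindex_ob y) |
    fmor p k = reindex_base f /\
    lift_arr c (t y) \o k = fmor G f \o lift_arr c (t x) } :=
  constructive_definite_description _
    (lift_cart c (t y) _ _ _ (reindex_base_eq f)).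

Lemma reindex_arr_unique (x y : X) (f : hom x y)
    (k : hom (reindex_ob x) (reindex_ob y)) :
  fmor p k = reindex_base f ->
  lift_arr c (t y) \o k = fmor G f \o lift_arr c (t x) ->
  proj1_sig (reindex_arr f) = k.
Proof.
intros Hk1 Hk2.
destruct (lift_cart c (t y) _ _ _ (reindex_base_eq f)) as [k0 [_ U]].
rewrite <- (U k (conj Hk1 Hk2)). symmetry. apply U.
exact (proj2_sig (reindex_arr f)).
Qed.

Definition reindex : Functor X E.
Proof.
refine (@MkFunctor X E reindex_ob (fun x y f => proj1_sig (reindex_arr f)) _ _).
- intros x. apply reindex_arr_unique.
  + unfold reindex_base.
    now rewrite !fmor_id, cmp_idr, eq_arr_trans, eq_arr_id.
  + now rewrite fmor_id, cmp_idl, cmp_idr.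
- intros x y z g f.
  destruct (proj2_sig (reindex_arr f)) as [f1 f2].
  destruct (proj2_sig (reindex_arr g)) as [g1 g2].
  apply reindex_arr_unique.
  + rewrite fmor_cmp, f1, g1. unfold reindex_base.
    rewrite !fmor_cmp, !cmp_assoc. f_equal. f_equal.
    rewrite <- (cmp_assoc _ (eq_arr (lift_over c (t y)))).
    now rewrite eq_arr_trans, eq_arr_id, cmp_idr.
  + rewrite fmor_cmp.
    refine (eq_trans (cmp_assoc _ _ _) _).
    refine (eq_trans (f_equal (fun k => k \o _) g2) _).
    refine (eq_trans (eq_sym (cmp_assoc _ _ _)) _).
    exact (eq_trans (f_equal (fun k => _ \o k) f2) (cmp_assoc _ _ _)).
Defined.

Definition reindex_nat : NatTrans reindex G :=
  @MkNatTrans X E reindex G (fun x => lift_arr c (t x))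
    (fun x y f => proj2 (proj2_sig (reindex_arr f))).

End Reindex.

(* The functor [Del] is not required to commute with the functors to [ctx]. *)

Record PlainDTT := MkPlainDTT {
  ctx : Category;
  ctx_one : ctx;
  ctx_one_terminal : forall x : ctx, exists! f : hom x ctx_one, True;
  ty : Category;
  tm : Category;
  uty : Functor ty ctx;
  utm : Functor tm ctx;
  uty_cleavage : Cleavage uty;
  utm_cleavage : Cleavage utm;
  Sig : Functor tm ty;
  Del : Functor ty tm;
  Sig_over : uty \O Sig = utm;
  adj : Adjunction Sig Del;
  Sig_cartesian : preserves_cartesian utm uty Sig;
  Del_cartesian : preserves_cartesian uty utm Del;
  unit_cartesian : forall a : tm, cartesian utm (unit adj a);
  counit_cartesian : forall A : ty, cartesian uty (counit adj A) }.

Arguments uty {_}.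
Arguments utm {_}.
Arguments uty_cleavage {_}.
Arguments utm_cleavage {_}.
Arguments Sig {_}.
Arguments Del {_}.
Arguments adj {_}.

Section Judgements.
Variable T : PlainDTT.

Definition is_type (Gam : ctx T) (A : ty T) : Prop := uty A = Gam.

Definition has_type (Gam : ctx T) (a : tm T) (A : ty T) : Prop :=
  utm a = Gam /\ Sig a = A.

Record type_eq (Gam : ctx T) (A A' : ty T) : Prop := MkTypeEq {
  type_eq_l : is_type Gam A;
  type_eq_r : is_type Gam A';
  type_eq_eq : A = A' }.

Record term_eq (Gam : ctx T) (a a' : tm T) (A : ty T) : Prop := MkTermEq {
  term_eq_l : has_type Gam a A;
  term_eq_r : has_type Gam a' A;
  term_eq_eq : a = a' }.

Definition ext (A : ty T) : ctx T := utm (Del A).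

Lemma has_type_is_type Gam a A : has_type Gam a A -> is_type Gam A.
Proof.
intros [h1 h2]. unfold is_type.
rewrite <- h1, <- h2. exact (fob_eq (Sig_over T) a).
Qed.

Lemma type_eq_ext Gam A A' B B' :
  type_eq Gam A A' -> type_eq (ext A) B B' -> is_type (ext A') B'.
Proof. intros [_ _ e] [_ h _]. now rewrite <- e. Qed.

(* The objects of the four categories below are the pairs (A,B), (A,b),
   (a,B), (a,b), with B a type and b a term over Gam.A (A = Sig a in the last
   two cases). *)
Definition TyTy : Category := Pullback (utm \O Del) (@uty T).
Definition TyTm : Category := Pullback (utm \O Del) (@utm T).
Definition TmTy : Category := Pullback (utm \O Del \O Sig) (@uty T).
Definition TmTm : Category := Pullback (utm \O Del \O Sig) (@utm T).

Definition TyTy_fst : Functor TyTy (ty T) := pb1 (utm \O Del) uty.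
Definition TyTy_snd : Functor TyTy (ty T) := pb2 (utm \O Del) uty.
Definition TyTm_fst : Functor TyTm (ty T) := pb1 (utm \O Del) utm.
Definition TyTm_snd : Functor TyTm (tm T) := pb2 (utm \O Del) utm.
Definition TmTy_fst : Functor TmTy (tm T) := pb1 (utm \O Del \O Sig) uty.
Definition TmTy_snd : Functor TmTy (ty T) := pb2 (utm \O Del \O Sig) uty.
Definition TmTm_fst : Functor TmTm (tm T) := pb1 (utm \O Del \O Sig) utm.
Definition TmTm_snd : Functor TmTm (tm T) := pb2 (utm \O Del \O Sig) utm.

Lemma TyTm_TyTy_eq : utm \O Del \O TyTm_fst = uty \O (Sig \O TyTm_snd).
Proof. rewrite FComp_assoc, Sig_over. apply pb_square. Qed.

(* (A,b) |-> (A, Sig b) *)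
Definition TyTm_TyTy : Functor TyTm TyTy := pb_pair TyTm_TyTy_eq.

Lemma TyTm_TyTy_fst : TyTy_fst \O TyTm_TyTy = TyTm_fst.
Proof. exact (pb1_pair TyTm_TyTy_eq). Qed.

Lemma TyTm_TyTy_snd : TyTy_snd \O TyTm_TyTy = Sig \O TyTm_snd.
Proof. exact (pb2_pair TyTm_TyTy_eq). Qed.

Lemma TmTm_TmTy_eq : utm \O Del \O Sig \O TmTm_fst = uty \O (Sig \O TmTm_snd).
Proof. rewrite (FComp_assoc uty), Sig_over. apply pb_square. Qed.

(* (a,b) |-> (a, Sig b) *)
Definition TmTm_TmTy : Functor TmTm TmTy := pb_pair TmTm_TmTy_eq.

Lemma TmTm_TmTy_fst : TmTy_fst \O TmTm_TmTy = TmTm_fst.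
Proof. exact (pb1_pair TmTm_TmTy_eq). Qed.

Lemma TmTm_TmTy_snd : TmTy_snd \O TmTm_TmTy = Sig \O TmTm_snd.
Proof. exact (pb2_pair TmTm_TmTy_eq). Qed.

Lemma TmTy_TyTy_eq : utm \O Del \O (Sig \O TmTy_fst) = uty \O TmTy_snd.
Proof. rewrite FComp_assoc. apply pb_square. Qed.

(* (a,B) |-> (Sig a, B) *)
Definition TmTy_TyTy : Functor TmTy TyTy := pb_pair TmTy_TyTy_eq.

Lemma TmTy_TyTy_fst : TyTy_fst \O TmTy_TyTy = Sig \O TmTy_fst.
Proof. exact (pb1_pair TmTy_TyTy_eq). Qed.

Lemma TmTy_TyTy_snd : TyTy_snd \O TmTy_TyTy = TmTy_snd.
Proof. exact (pb2_pair TmTy_TyTy_eq). Qed.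

Lemma TmTm_TyTm_eq : utm \O Del \O (Sig \O TmTm_fst) = utm \O TmTm_snd.
Proof. rewrite FComp_assoc. apply pb_square. Qed.

(* (a,b) |-> (Sig a, b) *)
Definition TmTm_TyTm : Functor TmTm TyTm := pb_pair TmTm_TyTm_eq.

Lemma TmTm_TyTm_fst : TyTm_fst \O TmTm_TyTm = Sig \O TmTm_fst.
Proof. exact (pb1_pair TmTm_TyTm_eq). Qed.

Lemma TmTm_TyTm_snd : TyTm_snd \O TmTm_TyTm = TmTm_snd.
Proof. exact (pb2_pair TmTm_TyTm_eq). Qed.

(* For a functor [p] to [ctx], the natural transformation with component
   utm (eta_a) : Gam -> Gam.A at a pair (a,z) with z over Gam.A. *)
Definition subst_nat (Z : Category) (p : Functor Z (ctx T)) :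
  NatTrans (utm \O pb1 (utm \O Del \O Sig) p) (p \O pb2 (utm \O Del \O Sig) p).
Proof.
refine (@MkNatTrans _ _
  (utm \O pb1 (utm \O Del \O Sig) p) (p \O pb2 (utm \O Del \O Sig) p)
  (fun x => eq_arr (pbo_eq x) \o fmor utm (unit adj (pbo1 x))) _).
intros x y f; simpl.
pose proof (f_equal (fmor (@utm T)) (ncomp_nat (unit adj) (pbh1 f))) as N.
rewrite !fmor_cmp in N; simpl in N.
pose proof (pbh_eq f) as P; simpl in P.
now rewrite <- cmp_assoc, N, cmp_assoc, P, cmp_assoc.
Defined.

(* (a,B) |-> B[a] and (a,b) |-> b[a] *)
Definition gamma : Functor TmTy (ty T) := reindex uty_cleavage (subst_nat uty).
Definition gammad : Functor TmTm (tm T) := reindex utm_cleavage (subst_nat utm).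

Lemma TyTy_ob_eq A B : is_type (ext A) B -> (utm \O Del) A = uty B.
Proof. intros h. symmetry. exact h. Qed.

Lemma TyTm_ob_eq A b B : has_type (ext A) b B -> (utm \O Del) A = utm b.
Proof. intros h. symmetry. exact (proj1 h). Qed.

Lemma TmTy_ob_eq Gam a A B :
  has_type Gam a A -> is_type (ext A) B -> (utm \O Del \O Sig) a = uty B.
Proof. intros [_ <-] h. symmetry. exact h. Qed.

Lemma TmTm_ob_eq Gam a A b B :
  has_type Gam a A -> has_type (ext A) b B -> (utm \O Del \O Sig) a = utm b.
Proof. intros [_ <-] h. symmetry. exact (proj1 h). Qed.

Definition tyty A B (hB : is_type (ext A) B) : TyTy := MkPb (TyTy_ob_eq hB).
Definition tytm A b B (hb : has_type (ext A) b B) : TyTm := MkPb (TyTm_ob_eq hb).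
Definition tmty Gam a A B (ha : has_type Gam a A) (hB : is_type (ext A) B) : TmTy :=
  MkPb (TmTy_ob_eq ha hB).
Definition tmtm Gam a A b B (ha : has_type Gam a A) (hb : has_type (ext A) b B) :
  TmTm := MkPb (TmTm_ob_eq ha hb).

(* B[a] and b[a] *)
Definition subst_ty Gam a A B (ha : has_type Gam a A) (hB : is_type (ext A) B) : ty T :=
  gamma (tmty ha hB).
Definition subst_tm Gam a A b B (ha : has_type Gam a A) (hb : has_type (ext A) b B) :
  tm T := gammad (tmtm ha hb).

Record PiTypes := MkPiTypes {
  Pi : Functor TyTy (ty T);
  lam : Functor TyTm (tm T);
  Pi_over : uty \O Pi = uty \O TyTy_fst;
  lam_pullback : is_pullback Pi Sig TyTm_TyTy lam }.

Section PiTypes.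
Variable P : PiTypes.

Definition Pi_ty A B (hB : is_type (ext A) B) : ty T := Pi P (tyty hB).
Definition lam_tm A b B (hb : has_type (ext A) b B) : tm T := lam P (tytm hb).

(* The triples (A,B,f) with Sig f = Pi_A B, and the functor (A,B,f) |-> f_B
   obtained from the universal property of the pullback square of lambda. *)
Definition PiTm : Category := Pullback (Pi P) Sig.
Definition PiTm_pair : Functor PiTm TyTy := pb1 (Pi P) Sig.
Definition PiTm_fun : Functor PiTm (tm T) := pb2 (Pi P) Sig.

Definition unlam : Functor PiTm TyTm :=
  proj1_sig (pb_induced (lam_pullback P) (pb_square (Pi P) Sig)).

Definition body : Functor PiTm (tm T) := TyTm_snd \O unlam.

(* The quadruples (A,B,f,a) with Sig a = A and Sig f = Pi_A B; the type A is
   determined by a. *)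
Definition Q : Category := Pullback (Pi P \O TmTy_TyTy) Sig.
Definition Q_pair : Functor Q TmTy := pb1 (Pi P \O TmTy_TyTy) Sig.
Definition Q_arg : Functor Q (tm T) := TmTy_fst \O Q_pair.
Definition Q_fun : Functor Q (tm T) := pb2 (Pi P \O TmTy_TyTy) Sig.

Lemma Q_PiTm_eq : Pi P \O (TmTy_TyTy \O Q_pair) = Sig \O Q_fun.
Proof. rewrite FComp_assoc. apply pb_square. Qed.

(* (A,B,f,a) |-> (A,B,f) *)
Definition Q_PiTm : Functor Q PiTm := pb_pair Q_PiTm_eq.

Lemma theta_eq :
  Pi P \O TmTy_TyTy \O TmTm_TmTy = Sig \O (lam P \O TmTm_TyTm).
Proof.
rewrite (FComp_assoc Sig), <- (proj1 (lam_pullback P)), <- !FComp_assoc.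
f_equal.
apply pb_functor_ext.
- change (TyTy_fst \O (TmTy_TyTy \O TmTm_TmTy) =
          TyTy_fst \O (TyTm_TyTy \O TmTm_TyTm)).
  now rewrite !FComp_assoc, TmTy_TyTy_fst, TyTm_TyTy_fst, <- FComp_assoc,
    TmTm_TmTy_fst, TmTm_TyTm_fst.
- change (TyTy_snd \O (TmTy_TyTy \O TmTm_TmTy) =
          TyTy_snd \O (TyTm_TyTy \O TmTm_TyTm)).
  now rewrite !FComp_assoc, TmTy_TyTy_snd, TyTm_TyTy_snd, <- FComp_assoc,
    TmTm_TmTy_snd, TmTm_TyTm_snd.
Qed.

(* (a,b) |-> (A, B, lambda_A b, a) with A = Sig a and B = Sig b *)
Definition theta : Functor TmTm Q := pb_pair theta_eq.

Lemma zeta_eq : utm \O Del \O Sig \O Q_arg = utm \O (body \O Q_PiTm).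
Proof.
unfold body.
rewrite (FComp_assoc utm), (FComp_assoc utm).
replace (utm \O TyTm_snd) with (utm \O Del \O TyTm_fst) by apply pb_square.
pose proof (proj1 (proj2_sig
  (pb_induced (lam_pullback P) (pb_square (Pi P) Sig)))) as E.
fold unlam in E. apply (f_equal (FComp TyTy_fst)) in E.
rewrite FComp_assoc in E.
rewrite TyTm_TyTy_fst in E.
change (TyTm_fst \O unlam = TyTy_fst \O PiTm_pair) in E.
change (utm \O Del \O Sig \O Q_arg = utm \O Del \O TyTm_fst \O unlam \O Q_PiTm).
rewrite <- (FComp_assoc _ TyTm_fst), E, <- (FComp_assoc _ _ Q_PiTm).
rewrite <- (FComp_assoc TyTy_fst).
replace (PiTm_pair \O Q_PiTm) with (TmTy_TyTy \O Q_pair)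
  by (symmetry; exact (pb1_pair Q_PiTm_eq)).
rewrite (FComp_assoc TyTy_fst), TmTy_TyTy_fst.
unfold Q_arg. now rewrite <- !FComp_assoc.
Qed.

(* (A,B,f,a) |-> (a, f_B) *)
Definition zeta : Functor Q TmTm := pb_pair zeta_eq.

Lemma PiTm_ob_eq Gam A B f (hB : is_type (ext A) B) :
  has_type Gam f (Pi_ty hB) -> Pi P (tyty hB) = Sig f.
Proof. intros h. symmetry. exact (proj2 h). Qed.

Lemma Q_ob_eq Gam A B f a (hB : is_type (ext A) B) (ha : has_type Gam a A) :
  has_type Gam f (Pi_ty hB) -> (Pi P \O TmTy_TyTy) (tmty ha hB) = Sig f.
Proof.
destruct ha as [h1 h2]; destruct h2. intros [_ h]. rewrite h.
unfold Pi_ty, tyty; simpl. do 2 f_equal. apply proof_irrelevance.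
Qed.

(* f_B and f(a), the latter being the value of the functor gammad zeta at
   (A,B,f,a) *)
Definition body_tm Gam A B f (hB : is_type (ext A) B)
  (hf : has_type Gam f (Pi_ty hB)) : tm T :=
  body (MkPb (PiTm_ob_eq hf) : PiTm).

Definition app_tm Gam A B f a (hB : is_type (ext A) B)
  (hf : has_type Gam f (Pi_ty hB)) (ha : has_type Gam a A) : tm T :=
  (gammad \O zeta) (MkPb (Q_ob_eq ha hf) : Q).

(* The judgemental theory generated by a plain dependent type theory with
   Pi-types.  Its categories are those whose identity functor is a rule. *)
Inductive rule : forall C D : Category, Functor C D -> Prop :=
| rule_uty : rule (@uty T)
| rule_utm : rule (@utm T)
| rule_Sig : rule (@Sig T)
| rule_Del : rule (@Del T)
| rule_Pi : rule (Pi P)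
| rule_lam : rule (lam P)
| rule_dom C D (F : Functor C D) : rule F -> rule (FId C)
| rule_cod C D (F : Functor C D) : rule F -> rule (FId D)
| rule_comp C D E (G : Functor D E) (F : Functor C D) :
    rule G -> rule F -> rule (G \O F)
| rule_pb1 A B C (F : Functor A C) (G : Functor B C) :
    rule F -> rule G -> rule (pb1 F G)
| rule_pb2 A B C (F : Functor A C) (G : Functor B C) :
    rule F -> rule G -> rule (pb2 F G)
| rule_pb_induced A B C (F : Functor A C) (G : Functor B C)
    L (p : Functor L A) (q : Functor L B) X (H : Functor X L) :
    rule F -> rule G -> rule p -> rule q -> is_pullback F G p q ->
    rule (p \O H) -> rule (q \O H) -> rule H
| rule_eq_incl A C (F G : Functor A C) :
    rule F -> rule G -> rule (eq_incl F G)
| rule_eq_induced A C (F G : Functor A C) L (i : Functor L A)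
    X (H : Functor X L) :
    rule F -> rule G -> rule i -> is_equalizer F G i ->
    rule (i \O H) -> rule H
| rule_power n A : rule (FId A) -> rule (FId (Power n A))
| rule_pow_proj n A (i : below n) : rule (FId A) -> rule (pow_proj A i)
| rule_pow_induced n A L (p : below n -> Functor L A) X (H : Functor X L) :
    rule (FId A) -> rule (FId L) -> rule (FId X) ->
    (forall i, rule (p i)) -> is_power p ->
    (forall i, rule (p i \O H)) -> rule H
| rule_lift_ty X (F : Functor X (ctx T)) (G : Functor X (ty T))
    (t : NatTrans F (uty \O G)) :
    rule F -> rule G -> policy t -> rule (reindex uty_cleavage t)
| rule_lift_tm X (F : Functor X (ctx T)) (G : Functor X (tm T))
    (t : NatTrans F (utm \O G)) :
    rule F -> rule G -> policy t -> rule (reindex utm_cleavage t)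
with policy : forall (C D : Category) (F G : Functor C D), NatTrans F G -> Prop :=
| policy_unit : policy (unit (@adj T))
| policy_counit : policy (counit (@adj T))
| policy_id C D (F G : Functor C D) (e : F = G) : rule F -> policy (eq_nat e)
| policy_vcomp C D (F G H : Functor C D) (t : NatTrans G H) (s : NatTrans F G) :
    policy t -> policy s -> policy (vcomp t s)
| policy_whiskerL C D E (K : Functor D E) (F G : Functor C D) (t : NatTrans F G) :
    rule K -> policy t -> policy (whiskerL K t)
| policy_whiskerR B C D (F G : Functor C D) (t : NatTrans F G) (K : Functor B C) :
    rule K -> policy t -> policy (whiskerR t K)
| policy_lift_ty X (F : Functor X (ctx T)) (G : Functor X (ty T))
    (t : NatTrans F (uty \O G)) :
    rule F -> rule G -> policy t -> policy (reindex_nat uty_cleavage t)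
| policy_lift_tm X (F : Functor X (ctx T)) (G : Functor X (tm T))
    (t : NatTrans F (utm \O G)) :
    rule F -> rule G -> policy t -> policy (reindex_nat utm_cleavage t).

End PiTypes.
End Judgements.

(* Main.v *)
Require Import Defs.
From Stdlib Require Import FunctionalExtensionality ProofIrrelevance.

(** The defining pullback square of [lam] inverts [lam]: a pair [(B, f)] with
    [f : Pi_A B] comes from a unique term [f_B] of type [B] over [Gam.A].
    Carrying along the argument [a], this makes [theta] and [zeta] mutually
    inverse, and every rule about [f(a) = f_B[a]] is read off from these two
    equations of functors, the typing of [f(a)] being the commutation of [Sig]
    with substitution. *)

Set Implicit Arguments.
Unset Strict Implicit.
Unset Printing Implicit Defensive.

(** * Composition of functors, natural transformations and strict pullbacks *)

Lemma FComp_idr (C D : Category) (F : Functor C D) : F \O FId C = F.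
Proof. destruct F. apply functor_eq_irr. Qed.

Lemma nat_trans_ext (C D : Category) (F G : Functor C D) (s t : NatTrans F G) :
  (forall x, s x = t x) -> s = t.
Proof.
destruct s as [s s'], t as [t t']; simpl; intros e.
assert (E : s = t) by now apply functional_extensionality_dep.
destruct E. f_equal. apply proof_irrelevance.
Qed.

Lemma Pullback_is_pullback (A B C : Category) (F : Functor A C)
    (G : Functor B C) : is_pullback F G (pb1 F G) (pb2 F G).
Proof.
split; [apply pb_square|].
intros X H K e. exists (pb_pair e). split.
- split; [apply pb1_pair|apply pb2_pair].
- intros L [<- <-]. apply pb_functor_ext; [apply pb1_pair|apply pb2_pair].
Qed.

(** The legs of any pullback square are jointly monic: [H] and [K] both mediate the same cone. This
    is needed for the square of [lam], whose apex is not literally a [Pullback], so that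
    [pb_functor_ext] does not apply. *)
Lemma is_pullback_functor_ext (A B C L : Category) (F : Functor A C)
    (G : Functor B C) (p : Functor L A) (q : Functor L B) :
  is_pullback F G p q -> forall (X : Category) (H K : Functor X L),
  p \O H = p \O K -> q \O H = q \O K -> H = K.
Proof.
intros [e pb] X H K e1 e2.
assert (E : F \O (p \O H) = G \O (q \O H))
  by now rewrite !FComp_assoc, e.
destruct (pb X _ _ E) as [M [_ U]].
rewrite <- (U H), <- (U K); auto.
Qed.

(** * The functors [theta] and [zeta] are mutually inverse *)

Section PiRules.
Variables (T : PlainDTT) (P : PiTypes T).

Lemma unlam_square : TyTm_TyTy T \O unlam P = PiTm_pair P.
Proof.
exact (proj1 (proj2_sig
  (pb_induced (lam_pullback P) (pb_square (Pi P) Sig)))).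
Qed.

Lemma lam_unlam : lam P \O unlam P = PiTm_fun P.
Proof.
exact (proj2 (proj2_sig
  (pb_induced (lam_pullback P) (pb_square (Pi P) Sig)))).
Qed.

(** The typing of f_B, as an equation of functors: the second component of [unlam_square]. *)
Lemma Sig_body : Sig \O body P = TyTy_snd T \O PiTm_pair P.
Proof.
unfold body.
now rewrite FComp_assoc, <- TyTm_TyTy_snd, <- FComp_assoc, unlam_square.
Qed.

Lemma Q_PiTm_pair : PiTm_pair P \O Q_PiTm P = TmTy_TyTy T \O Q_pair P.
Proof. exact (pb1_pair (Q_PiTm_eq P)). Qed.

Lemma Q_PiTm_fun : PiTm_fun P \O Q_PiTm P = Q_fun P.
Proof. exact (pb2_pair (Q_PiTm_eq P)). Qed.

Lemma theta_pair : Q_pair P \O theta P = TmTm_TmTy T.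
Proof. exact (pb1_pair (theta_eq P)). Qed.

Lemma theta_fun : Q_fun P \O theta P = lam P \O TmTm_TyTm T.
Proof. exact (pb2_pair (theta_eq P)). Qed.

Lemma zeta_fst : TmTm_fst T \O zeta P = Q_arg P.
Proof. exact (pb1_pair (zeta_eq P)). Qed.

Lemma zeta_snd : TmTm_snd T \O zeta P = body P \O Q_PiTm P.
Proof. exact (pb2_pair (zeta_eq P)). Qed.

(** Since f_B has type B, going through [zeta] loses neither a nor B. This is the first half of
    [theta_zeta]. *)
Lemma TmTm_TmTy_zeta : TmTm_TmTy T \O zeta P = Q_pair P.
Proof.
apply pb_functor_ext.
- change (TmTy_fst T \O (TmTm_TmTy T \O zeta P) = TmTy_fst T \O Q_pair P).
  rewrite FComp_assoc, TmTm_TmTy_fst. apply zeta_fst.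
- change (TmTy_snd T \O (TmTm_TmTy T \O zeta P) = TmTy_snd T \O Q_pair P).
  rewrite FComp_assoc, TmTm_TmTy_snd, <- FComp_assoc, zeta_snd, FComp_assoc.
  now rewrite Sig_body, <- FComp_assoc, Q_PiTm_pair, FComp_assoc, TmTy_TyTy_snd.
Qed.

(** Both sides send (A,B,f,a) to (A, f_B), so applying [lam] afterwards recovers f. This is the
    second half of [theta_zeta]. *)
Lemma TmTm_TyTm_zeta : TmTm_TyTm T \O zeta P = unlam P \O Q_PiTm P.
Proof.
apply pb_functor_ext.
- change (TyTm_fst T \O (TmTm_TyTm T \O zeta P) =
          TyTm_fst T \O (unlam P \O Q_PiTm P)).
  rewrite FComp_assoc, TmTm_TyTm_fst, <- FComp_assoc, zeta_fst.
  rewrite <- TyTm_TyTy_fst, <- FComp_assoc, (FComp_assoc (TyTm_TyTy T)).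
  rewrite unlam_square, Q_PiTm_pair, FComp_assoc, TmTy_TyTy_fst.
  unfold Q_arg. apply FComp_assoc.
- change (TyTm_snd T \O (TmTm_TyTm T \O zeta P) =
          TyTm_snd T \O (unlam P \O Q_PiTm P)).
  now rewrite FComp_assoc, TmTm_TyTm_snd, zeta_snd, FComp_assoc.
Qed.

Lemma theta_zeta : theta P \O zeta P = FId (Q P).
Proof.
apply pb_functor_ext.
- change (Q_pair P \O (theta P \O zeta P) = Q_pair P \O FId (Q P)).
  now rewrite FComp_assoc, theta_pair, FComp_idr, TmTm_TmTy_zeta.
- change (Q_fun P \O (theta P \O zeta P) = Q_fun P \O FId (Q P)).
  rewrite FComp_assoc, theta_fun, FComp_idr, <- FComp_assoc, TmTm_TyTm_zeta.
  now rewrite FComp_assoc, lam_unlam, Q_PiTm_fun.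
Qed.

Lemma TmTm_square : TyTm_TyTy T \O TmTm_TyTm T = TmTy_TyTy T \O TmTm_TmTy T.
Proof.
apply pb_functor_ext.
- change (TyTy_fst T \O (TyTm_TyTy T \O TmTm_TyTm T) =
          TyTy_fst T \O (TmTy_TyTy T \O TmTm_TmTy T)).
  now rewrite !FComp_assoc, TmTy_TyTy_fst, TyTm_TyTy_fst, <- FComp_assoc,
    TmTm_TmTy_fst, TmTm_TyTm_fst.
- change (TyTy_snd T \O (TyTm_TyTy T \O TmTm_TyTm T) =
          TyTy_snd T \O (TmTy_TyTy T \O TmTm_TmTy T)).
  now rewrite !FComp_assoc, TmTy_TyTy_snd, TyTm_TyTy_snd, <- FComp_assoc,
    TmTm_TmTy_snd, TmTm_TyTm_snd.
Qed.

(** The body of lambda_A b is b: both sides have the components (A, Sig b) and lambda_A b along the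
    legs of the square of [lam], hence agree by uniqueness in its universal property. *)
Lemma unlam_theta : unlam P \O Q_PiTm P \O theta P = TmTm_TyTm T.
Proof.
apply (is_pullback_functor_ext (lam_pullback P)).
- rewrite !FComp_assoc, unlam_square, Q_PiTm_pair, <- FComp_assoc, theta_pair.
  symmetry. apply TmTm_square.
- now rewrite !FComp_assoc, lam_unlam, Q_PiTm_fun, theta_fun.
Qed.

Lemma zeta_theta : zeta P \O theta P = FId (TmTm T).
Proof.
apply pb_functor_ext.
- change (TmTm_fst T \O (zeta P \O theta P) = TmTm_fst T \O FId (TmTm T)).
  rewrite FComp_assoc, zeta_fst, FComp_idr. unfold Q_arg.
  now rewrite <- FComp_assoc, theta_pair, TmTm_TmTy_fst.
- change (TmTm_snd T \O (zeta P \O theta P) = TmTm_snd T \O FId (TmTm T)).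
  rewrite FComp_assoc, zeta_snd, FComp_idr. unfold body.
  now rewrite <- !FComp_assoc, (FComp_assoc (unlam P)), unlam_theta, TmTm_TyTm_snd.
Qed.

(** * Generation of the rules *)

Lemma rule_pb_pair (A B C X : Category) (F : Functor A C) (G : Functor B C)
    (H : Functor X A) (K : Functor X B) (e : F \O H = G \O K) :
  rule P F -> rule P G -> rule P H -> rule P K -> rule P (pb_pair e).
Proof.
intros hF hG hH hK.
apply (@rule_pb_induced T P A B C F G _ (pb1 F G) (pb2 F G)); auto.
- now apply rule_pb1.
- now apply rule_pb2.
- apply Pullback_is_pullback.
- now rewrite pb1_pair.
- now rewrite pb2_pair.
Qed.

(** Descends along the visible form of the functor. Named composites must be unfolded beforehand or
    have their rule facts among the hypotheses. *)
Ltac solve_rule :=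
  repeat lazymatch goal with
  | |- rule _ (pb_pair _) => apply rule_pb_pair
  | |- rule _ (pb1 _ _) => apply rule_pb1
  | |- rule _ (pb2 _ _) => apply rule_pb2
  | |- rule _ (_ \O _) => apply rule_comp
  | |- rule _ uty => apply rule_uty
  | |- rule _ utm => apply rule_utm
  | |- rule _ Sig => apply rule_Sig
  | |- rule _ Del => apply rule_Del
  | |- rule _ (Pi _) => apply rule_Pi
  | |- rule _ (lam _) => apply rule_lam
  | |- _ => eassumption
  end.

Lemma rule_TyTm_TyTy : rule P (TyTm_TyTy T).
Proof. unfold TyTm_TyTy, TyTm_fst, TyTm_snd. solve_rule. Qed.

Lemma rule_TmTy_TyTy : rule P (TmTy_TyTy T).
Proof. unfold TmTy_TyTy, TmTy_fst, TmTy_snd. solve_rule. Qed.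

Lemma rule_TmTm_TmTy : rule P (TmTm_TmTy T).
Proof. unfold TmTm_TmTy, TmTm_fst, TmTm_snd. solve_rule. Qed.

Lemma rule_TmTm_TyTm : rule P (TmTm_TyTm T).
Proof. unfold TmTm_TyTm, TmTm_fst, TmTm_snd. solve_rule. Qed.

(** [unlam] is picked by unique description, but [rule_pb_induced] only asks that its composites
    with the two legs be rules, and these are the projections of [PiTm]. *)
Lemma rule_unlam : rule P (unlam P).
Proof.
apply (rule_pb_induced (rule_Pi P) (rule_Sig P) rule_TyTm_TyTy (rule_lam P)
         (lam_pullback P)).
- rewrite unlam_square. unfold PiTm_pair. solve_rule.
- rewrite lam_unlam. unfold PiTm_fun. solve_rule.
Qed.

Lemma rule_body : rule P (body P).
Proof.
apply rule_comp; [unfold TyTm_snd; solve_rule|apply rule_unlam].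
Qed.

Lemma rule_theta : rule P (theta P).
Proof.
pose proof rule_TmTy_TyTy. pose proof rule_TmTm_TmTy. pose proof rule_TmTm_TyTm.
unfold theta. solve_rule.
Qed.

Lemma rule_Q_pair : rule P (Q_pair P).
Proof. pose proof rule_TmTy_TyTy. unfold Q_pair. solve_rule. Qed.

Lemma rule_Q_PiTm : rule P (Q_PiTm P).
Proof.
pose proof rule_TmTy_TyTy. pose proof rule_Q_pair.
unfold Q_PiTm, Q_fun. solve_rule.
Qed.

Lemma rule_zeta : rule P (zeta P).
Proof.
pose proof rule_Q_pair. pose proof rule_body. pose proof rule_Q_PiTm.
unfold zeta, Q_arg, TmTy_fst. solve_rule.
Qed.

(* [subst_nat] is the whiskering of the unit by [utm] and the first projection,
   up to the canonical identifications of composite functors. *)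
Lemma policy_subst_nat (Z : Category) (p : Functor Z (ctx T)) :
  rule P p -> policy P (subst_nat p).
Proof.
intros hp.
assert (h1 : rule P (pb1 (utm \O Del \O Sig) p)) by solve_rule.
pose (e1 := f_equal (fun K => K \O pb1 (utm \O Del \O Sig) p)
              (eq_sym (FComp_idr (@utm T)))).
pose (e2 := eq_trans
  (f_equal (fun K => K \O pb1 (utm \O Del \O Sig) p)
     (FComp_assoc (@utm T) Del Sig)) (pb_square (utm \O Del \O Sig) p)).
replace (subst_nat p) with
  (vcomp (eq_nat e2) (vcomp
     (whiskerR (whiskerL utm (unit adj)) (pb1 (utm \O Del \O Sig) p))
     (eq_nat e1))).
- apply policy_vcomp; [apply policy_id; solve_rule|].
  apply policy_vcomp; [|apply policy_id; solve_rule].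
  apply policy_whiskerR; [exact h1|].
  apply policy_whiskerL; [solve_rule|apply policy_unit].
- apply nat_trans_ext. intros x. simpl.
  rewrite eq_arr_id, cmp_idr. f_equal. apply eq_arr_irr.
Qed.

(** Substitution is the lifting of the policy [subst_nat] along the fibration of terms. *)
Lemma rule_gammad : rule P (gammad T).
Proof.
unfold gammad. apply rule_lift_tm; solve_rule.
apply policy_subst_nat. solve_rule.
Qed.

(** * The judgements *)

Lemma uty_Sig (a : tm T) : uty (Sig a) = utm a.
Proof. exact (fob_eq (Sig_over T) a). Qed.

Lemma utm_gammad (x : TmTm T) : utm (gammad T x) = utm (TmTm_fst T x).
Proof. exact (lift_over utm_cleavage (subst_nat utm x)). Qed.

(** The typings Sig a = A and Sig b = B are propositional equations, so the functors do not compute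
    to the expected objects built from A and B. This lemma and the next three supply the
    identifications. *)
Lemma TmTy_TyTy_tmty Gam (a : tm T) (A B : ty T) (ha : has_type Gam a A)
    (hB : is_type (ext A) B) : TmTy_TyTy T (tmty ha hB) = tyty hB.
Proof. apply pb_ob_ext; [exact (proj2 ha)|reflexivity]. Qed.

Lemma TyTm_TyTy_tytm (A B : ty T) (b : tm T) (hb : has_type (ext A) b B) :
  TyTm_TyTy T (tytm hb) = tyty (has_type_is_type hb).
Proof. apply pb_ob_ext; [reflexivity|exact (proj2 hb)]. Qed.

Lemma TmTm_TmTy_tmtm Gam (a : tm T) (A B : ty T) (b : tm T)
    (ha : has_type Gam a A) (hb : has_type (ext A) b B) :
  TmTm_TmTy T (tmtm ha hb) = tmty ha (has_type_is_type hb).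
Proof. apply pb_ob_ext; [reflexivity|exact (proj2 hb)]. Qed.

Lemma TmTm_TyTm_tmtm Gam (a : tm T) (A B : ty T) (b : tm T)
    (ha : has_type Gam a A) (hb : has_type (ext A) b B) :
  TmTm_TyTm T (tmtm ha hb) = tytm hb.
Proof. apply pb_ob_ext; [exact (proj2 ha)|reflexivity]. Qed.

(** * Body and application for a given function term and argument *)

Section Elimination.
Variables (Gam : ctx T) (A B : ty T) (f : tm T) (hB : is_type (ext A) B)
  (hf : has_type Gam f (Pi_ty P hB)).

(** Stated for an arbitrary typing proof [hb], so that it rewrites whichever proof occurs in the
    goal. *)
Lemma unlam_ob (hb : has_type (ext A) (body_tm hf) B) :
  unlam P (MkPb (PiTm_ob_eq hf)) = tytm hb.
Proof.
apply pb_ob_ext; [|reflexivity].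
exact (f_equal (TyTy_fst T) (fob_eq unlam_square (MkPb (PiTm_ob_eq hf)))).
Qed.

Lemma body_tm_has_type : has_type (ext A) (body_tm hf) B.
Proof.
assert (h : Sig (body_tm hf) = B)
  by exact (fob_eq Sig_body (MkPb (PiTm_ob_eq hf))).
split; [|exact h].
rewrite <- uty_Sig, h. exact hB.
Qed.

(** The eta rule on objects: [lam_unlam] evaluated at (A,B,f). *)
Lemma lam_body_tm (hb : has_type (ext A) (body_tm hf) B) : lam_tm P hb = f.
Proof.
unfold lam_tm. rewrite <- (unlam_ob hb).
exact (fob_eq lam_unlam (MkPb (PiTm_ob_eq hf))).
Qed.

Variables (a : tm T) (ha : has_type Gam a A).

Lemma Q_PiTm_ob : Q_PiTm P (MkPb (Q_ob_eq ha hf)) = MkPb (PiTm_ob_eq hf).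
Proof. apply pb_ob_ext; [exact (TmTy_TyTy_tmty ha hB)|reflexivity]. Qed.

Lemma zeta_ob (hb : has_type (ext A) (body_tm hf) B) :
  zeta P (MkPb (Q_ob_eq ha hf)) = tmtm ha hb.
Proof. apply pb_ob_ext; [reflexivity|]. exact (f_equal (body P) Q_PiTm_ob). Qed.

Lemma app_tm_subst (hb : has_type (ext A) (body_tm hf) B) :
  app_tm hf ha = subst_tm ha hb.
Proof. exact (f_equal (gammad T) (zeta_ob hb)). Qed.

End Elimination.

(** * Typing of substitution, application and abstraction, and the beta rule *)

Lemma subst_tm_has_type (subst_square : Sig \O gammad T = gamma T \O TmTm_TmTy T)
    Gam (a : tm T) (A B : ty T) (b : tm T) (ha : has_type Gam a A)
    (hB : is_type (ext A) B) (hb : has_type (ext A) b B) :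
  has_type Gam (subst_tm ha hb) (subst_ty ha hB).
Proof.
split.
- exact (eq_trans (utm_gammad (tmtm ha hb)) (proj1 ha)).
(* With the proof of [is_type] taken from [hb], the target is [gamma] at the image of (a,b) under
   [TmTm_TmTy], and the commutation of [Sig] with substitution applies. *)
- rewrite (proof_irrelevance _ hB (has_type_is_type hb)).
  refine (eq_trans (fob_eq subst_square (tmtm ha hb)) _).
  exact (f_equal (gamma T) (TmTm_TmTy_tmtm ha hb)).
Qed.

Lemma app_tm_has_type (subst_square : Sig \O gammad T = gamma T \O TmTm_TmTy T)
    Gam (A B : ty T) (f a : tm T) (hB : is_type (ext A) B)
    (hf : has_type Gam f (Pi_ty P hB)) (ha : has_type Gam a A) :
  has_type Gam (app_tm hf ha) (subst_ty ha hB).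
Proof.
rewrite (app_tm_subst ha (body_tm_has_type hf)).
now apply subst_tm_has_type.
Qed.

Lemma Pi_ty_is_type Gam (A B : ty T) (hB : is_type (ext A) B) :
  is_type Gam A -> is_type Gam (Pi_ty P hB).
Proof. intros hA. exact (eq_trans (fob_eq (Pi_over P) (tyty hB)) hA). Qed.

Lemma lam_tm_has_type Gam (A B : ty T) (b : tm T) (hb : has_type (ext A) b B) :
  is_type Gam A -> has_type Gam (lam_tm P hb) (Pi_ty P (has_type_is_type hb)).
Proof.
intros hA.
assert (h : Sig (lam_tm P hb) = Pi_ty P (has_type_is_type hb)).
(* The commutation of the square of [lam] at (A,b) gives the type; the context then follows from
   that of the type. *)
{ unfold Pi_ty. rewrite <- TyTm_TyTy_tytm. symmetry.
  exact (fob_eq (proj1 (lam_pullback P)) (tytm hb)). }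
split; [|exact h].
rewrite <- uty_Sig, h. now apply Pi_ty_is_type.
Qed.

Lemma app_lam_tm Gam (A B : ty T) (a b : tm T) (hb : has_type (ext A) b B)
    (hl : has_type Gam (lam_tm P hb) (Pi_ty P (has_type_is_type hb)))
    (ha : has_type Gam a A) : app_tm hl ha = subst_tm ha hb.
Proof.
(* The quadruple (A, B, lambda_A b, a) is the value of [theta] at (a,b), so beta becomes
   [zeta_theta] at (a,b) followed by substitution. *)
assert (E : MkPb (Q_ob_eq ha hl) = theta P (tmtm ha hb)).
{ apply pb_ob_ext.
  - symmetry. exact (TmTm_TmTy_tmtm ha hb).
  - symmetry. exact (f_equal (lam P) (TmTm_TyTm_tmtm ha hb)). }
unfold app_tm. rewrite E.
exact (f_equal (gammad T) (fob_eq zeta_theta (tmtm ha hb))).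
Qed.

End PiRules.

Theorem mainTheorem9 :
  forall (T : PlainDTT) (P : PiTypes T)
    (* Sig (b[a]) = (Sig b)[a] *)
    (subst_square : Sig \O gammad T = gamma T \O TmTm_TmTy T),
  (* the functors theta and zeta, the term f_B, and f(a) = f_B[a] *)
  (theta P \O zeta P = FId (Q P) /\
   zeta P \O theta P = FId (TmTm T) /\
   gammad T \O zeta P \O theta P = gammad T /\
   (forall (Gam : ctx T) (A B : ty T) (f : tm T) (hB : is_type (ext A) B)
      (hf : has_type Gam f (Pi_ty P hB)),
      has_type (ext A) (body_tm hf) B) /\
   (forall (Gam : ctx T) (A B : ty T) (f a : tm T) (hB : is_type (ext A) B)
      (hf : has_type Gam f (Pi_ty P hB)) (ha : has_type Gam a A)
      (hb : has_type (ext A) (body_tm hf) B),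
      app_tm hf ha = subst_tm ha hb) /\
   rule P (Pi P) /\ rule P (lam P) /\ rule P (body P) /\
   rule P (theta P) /\ rule P (zeta P) /\ rule P (gammad T \O zeta P)) /\
  (* Pi F *)
  (forall (Gam : ctx T) (A B : ty T),
     is_type Gam A -> forall hB : is_type (ext A) B,
     is_type Gam (Pi_ty P hB)) /\
  (* Pi I *)
  (forall (Gam : ctx T) (A B : ty T) (b : tm T),
     is_type Gam A -> forall hb : has_type (ext A) b B,
     has_type Gam (lam_tm P hb) (Pi_ty P (has_type_is_type hb))) /\
  (* Pi E *)
  (forall (Gam : ctx T) (A B : ty T) (f a : tm T) (hB : is_type (ext A) B)
     (hf : has_type Gam f (Pi_ty P hB)) (ha : has_type Gam a A),
     has_type Gam (app_tm hf ha) (subst_ty ha hB)) /\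
  (* Pi beta *)
  (forall (Gam : ctx T) (A B : ty T) (b a : tm T)
     (hb : has_type (ext A) b B) (ha : has_type Gam a A),
     exists hl : has_type Gam (lam_tm P hb) (Pi_ty P (has_type_is_type hb)),
     term_eq Gam (app_tm hl ha) (subst_tm ha hb)
       (subst_ty ha (has_type_is_type hb))) /\
  (* Pi eta *)
  (forall (Gam : ctx T) (A B : ty T) (f : tm T) (hB : is_type (ext A) B)
     (hf : has_type Gam f (Pi_ty P hB)),
     exists hb : has_type (ext A) (body_tm hf) B,
     term_eq Gam f (lam_tm P hb) (Pi_ty P hB)) /\
  (* Pi F= *)
  (forall (Gam : ctx T) (A A' B B' : ty T)
     (hA : type_eq Gam A A') (hB : type_eq (ext A) B B'),
     type_eq Gam (Pi_ty P (type_eq_l hB)) (Pi_ty P (type_eq_ext hA hB))) /\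
  (* Pi I= *)
  (forall (Gam : ctx T) (A B : ty T) (b b' : tm T),
     type_eq Gam A A -> forall hb : term_eq (ext A) b b' B,
     term_eq Gam (lam_tm P (term_eq_l hb)) (lam_tm P (term_eq_r hb))
       (Pi_ty P (has_type_is_type (term_eq_l hb)))) /\
  (* Pi E= *)
  (forall (Gam : ctx T) (A B : ty T) (f f' a a' : tm T)
     (hB : is_type (ext A) B)
     (hf : term_eq Gam f f' (Pi_ty P hB)) (ha : term_eq Gam a a' A),
     term_eq Gam
       (app_tm (term_eq_l hf) (term_eq_l ha))
       (app_tm (term_eq_r hf) (term_eq_r ha))
       (subst_ty (term_eq_l ha) hB)).
Proof.
intros T P subst_square.
repeat apply conj.
- apply theta_zeta.
- apply zeta_theta.
- now rewrite <- FComp_assoc, zeta_theta, FComp_idr.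
- intros. apply body_tm_has_type.
- intros. apply app_tm_subst.
- apply rule_Pi.
- apply rule_lam.
- apply rule_body.
- apply rule_theta.
- apply rule_zeta.
- apply rule_comp; [apply rule_gammad|apply rule_zeta].
- intros Gam A B hA hB. now apply Pi_ty_is_type.
- intros Gam A B b hA hb. now apply lam_tm_has_type.
- intros. now apply app_tm_has_type.
- intros Gam A B b a hb ha.
  (* That A is a type over [Gam] is read off from the typing of a. *)
  exists (lam_tm_has_type P hb (has_type_is_type ha)). split.
  + now apply app_tm_has_type.
  + now apply subst_tm_has_type.
  + apply app_lam_tm.
- intros Gam A B f hB hf. exists (body_tm_has_type hf).
  split; rewrite ?lam_body_tm; auto.
- intros Gam A A' B B' hA hB. split.
  + apply Pi_ty_is_type, (type_eq_l hA).
  + apply Pi_ty_is_type, (type_eq_r hA).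
  + unfold Pi_ty. f_equal.
    apply pb_ob_ext; [exact (type_eq_eq hA)|exact (type_eq_eq hB)].
(* Once b and b' are identified, the two abstractions differ only in their typing proofs. The
   congruence rule for application below is treated in the same way. *)
- intros Gam A B b b' hA hb. destruct (term_eq_eq hb).
  rewrite (proof_irrelevance _ (term_eq_r hb) (term_eq_l hb)).
  split; auto; apply lam_tm_has_type, (type_eq_l hA).
- intros Gam A B f f' a a' hB hf ha.
  destruct (term_eq_eq hf), (term_eq_eq ha).
  rewrite (proof_irrelevance _ (term_eq_r hf) (term_eq_l hf)).
  rewrite (proof_irrelevance _ (term_eq_r ha) (term_eq_l ha)).
  split; auto; now apply app_tm_has_type.
Qed.
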